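(* Let $d,n,M\in\mathbb{N}$, $t_1,\dots,t_M\in[0,1)^d$, $z_j:=\mathrm{e}^{2\pi\mathrm{i}t_j}$, $q>0$, and let $\Omega:=\{z_j:j=1,\dots,M\}$ be $q$-separated. Let $\hat f_1,\dots,\hat f_M\in\mathbb{C}\setminus\{0\}$ and let $T=T_n(f)$ be the multilevel Toeplitz matrix of $f(k)=\sum_{j=1}^M\hat f_jz_j^k$, $k\in\mathbb{Z}^d$. If $n\ge2dq^{-1}$, then $$\Omega\subset V(\ker T)\cap\mathbb{T}^d\subset\{z\,\mathrm{e}^{2\pi\mathrm{i}t}:z\in\Omega,\ t\in\mathbb{R}^d,\ \|t\|_\infty<2d/n\},$$ where $z\,\mathrm{e}^{2\pi\mathrm{i}t}$ denotes the componentwise product.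
   Context: For $t\in\mathbb{R}^d$ write $\mathrm{e}^{2\pi\mathrm{i}t}:=(\mathrm{e}^{2\pi\mathrm{i}t_1},\dots,\mathrm{e}^{2\pi\mathrm{i}t_d})\in\mathbb{T}^d$, where $\mathbb{T}=\{z\in\mathbb{C}:|z|=1\}$. For $z\in(\mathbb{C}\setminus\{0\})^d$ and $k\in\mathbb{Z}^d$ write $z^k:=z_1^{k_1}\cdots z_d^{k_d}$. The separation distance of $\Omega=\{\mathrm{e}^{2\pi\mathrm{i}t_j}:j=1,\dots,M\}$ is $\operatorname{sep}(\Omega):=\min_{r\in\mathbb{Z}^d,\ j\ne\ell}\|t_j-t_\ell+r\|_\infty$ (the minimum over all $r\in\mathbb{Z}^d$ and all indices $j\neq\ell$ in $\{1,\dots,M\}$; it is $+\infty$ if $M=1$). $\Omega$ is called $q$-separated if $\operatorname{sep}(\Omega)>q$; in particular the $t_j$ are then pairwise distinct. Let $I_n:=\{0,\dots,n\}^d$ and $N:=|I_n|=(n+1)^d$. For $f\colon\mathbb{Z}^d\to\mathbb{C}$, the matrix $T_n(f)\in\mathbb{C}^{N\times N}$ has entry $f(k-\ell)$ in row $\ell\in I_n$ and column $k\in I_n$; that is, $(T_n(f)\hat p)_\ell=\sum_{k\in I_n}f(k-\ell)\hat p_k$. A vector $\hat p=(\hat p_k)_{k\in I_n}\in\mathbb{C}^N$ is identified with the polynomial $p=\sum_{k\in I_n}\hat p_kZ_1^{k_1}\cdots Z_d^{k_d}$, so $\ker T$ is regarded as a set of polynomials. For a set $P$ of polynomials, $V(P):=\{z\in\mathbb{C}^d:p(z)=0\text{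 for all }p\in P\}$. *)

(* Defs.v *)
From HB Require Import structures.
From mathcomp Require Import all_boot all_order all_algebra.
From mathcomp Require Import complex.
From mathcomp Require mpoly.
From mathcomp Require Import all_classical all_reals all_analysis.
(* The notations of mpoly clash with those of MathComp-Analysis. *)
Import -(notations) mpoly.

Set Implicit Arguments.
Unset Strict Implicit.
Unset Printing Implicit Defensive.
Import Order.TTheory GRing.Theory Num.Theory numFieldNormedType.Exports.
Local Open Scope classical_set_scope.
Local Open Scope complex_scope.
Local Open Scope ring_scope.

(* exp(2 pi i t), componentwise. *)
Definition torus_exp (R : realType) (d : nat) (t : 'rV[R]_d) : 'rV[R[i]]_d :=
  \row_i (cos (2 * pi * t 0 i) +i* sin (2 * pi * t 0 i)).

Definition torus (R : realType) (d : nat) : set 'rV[R[i]]_d :=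
  [set z | forall i, `|z 0 i| = 1].
Arguments torus : clear implicits.

Definition hadamard (R : realType) (d : nat) (z w : 'rV[R[i]]_d) :
    'rV[R[i]]_d :=
  \row_i (z 0 i * w 0 i).

Definition zpow (R : realType) (d : nat) (z : 'rV[R[i]]_d) (k : 'rV[int]_d) :
    R[i] :=
  \prod_i (z 0 i) ^ (k 0 i).

(* `|_| on 'rV[R]_d is the sup norm. The infimum in \bar R is attained for
   M >= 2, and is +oo for M = 1. *)
Definition sep (R : realType) (d M : nat) (t : 'I_M -> 'rV[R]_d) : \bar R :=
  ereal_inf [set x | exists (r : 'rV[int]_d) (j l : 'I_M),
    j != l /\ x = (`| t j - t l + map_mx intr r |)%:E].

Definition q_separated (R : realType) (d M : nat) (q : R)
    (t : 'I_M -> 'rV[R]_d) : Prop :=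
  (q%:E < sep t)%E.

(* I_n = {0, ..., n}^d; matrix rows and columns are numbered by 'I_#|I_n|
   through the enumeration enum_val. *)
Notation multi_index d n := {ffun 'I_d -> 'I_n.+1}.

Definition multi_index_int (d n : nat) (k : multi_index d n) : 'rV[int]_d :=
  \row_i (k i)%:Z.

Definition multi_index_mnm (d n : nat) (k : multi_index d n) : multinom d :=
  Multinom [tuple (k i : nat) | i < d].

Definition toeplitz_mx (R : realType) (d n : nat) (f : 'rV[int]_d -> R[i]) :
    'M[R[i]]_#|{: multi_index d n}| :=
  \matrix_(l, k)
    f (multi_index_int (enum_val k) - multi_index_int (enum_val l)).

Definition poly_of_vec (R : realType) (d n : nat)
    (p : 'cV[R[i]]_#|{: multi_index d n}|) : mpoly d R[i] :=
  \sum_k p k 0 *: mpolyX R[i] (multi_index_mnm (enum_val k)).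

Definition ker_poly (R : realType) (d n : nat)
    (T : 'M[R[i]]_#|{: multi_index d n}|) : set (mpoly d R[i]) :=
  [set poly_of_vec p | p in [set p | T *m p = 0]].

Definition zero_locus (R : realType) (d : nat) (P : set (mpoly d R[i])) :
    set 'rV[R[i]]_d :=
  [set z | forall p, P p -> meval (z 0) p = 0].

(* Main.v *)
(* Suppose the points t_j have pairwise sup-distance at least e = 2d/n modulo
   Z^d. With N = n %/ 2d, the normalised Dirichlet kernel
   p(z) = ((1 + z + ... + z^N) / (N + 1))^(2d) has degree at most n, p(1) = 1,
   |p| <= 1 on the circle, and |p(exp(2 pi i x))| <= 4^-d m^(-2d) as soon as
   m e <= |x| <= 1/2. Cut R^d around t_j into 2^d orthants of cubes of side e:
   each cube holds at most one point, and the cubes at the centre only t_j.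
   Summing the product kernel over the cubes gives total mass less than 1 away
   from t_j, so diagonal dominance makes the vectors (z_j^k)_k, k in I_n,
   linearly independent.
   The Toeplitz matrix factors as T = A^* D A with A the Vandermonde matrix of
   the z_j, and A^* is injective, so ker T consists of the polynomials vanishing
   on Omega. A point w of the torus at distance at least e from Omega can be
   added to the family, and interpolation yields a polynomial in ker T which
   does not vanish at w. *)
Require Import Defs.
From HB Require Import structures.
From mathcomp Require Import all_boot all_order all_algebra.
From mathcomp Require Import complex.
From mathcomp Require mpoly.
From mathcomp Require Import all_classical all_reals all_analysis.
Import -(notations) mpoly.
From mathcomp Require Import ring lra.

Import Order.TTheory GRing.Theory Num.Theory numFieldNormedType.Exports.
Local Open Scope classical_set_scope.
Local Open Scope complex_scope.
Local Open Scope ring_scope.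

Set Implicit Arguments.
Unset Strict Implicit.
Unset Printing Implicit Defensive.

(** * The one-dimensional character of the circle *)

Definition cis (R : realType) (x : R) : R[i] :=
  cos (2 * pi * x) +i* sin (2 * pi * x).

Lemma cisD (R : realType) (x y : R) : cis (x + y) = cis x * cis y.
Proof. by rewrite /cis mulrDr cosD sinD /GRing.mul /= addrC [X in _ +i* X]addrC. Qed.

Lemma cis0 (R : realType) : cis (0 : R) = 1.
Proof. by rewrite /cis mulr0 cos0 sin0. Qed.

Lemma cisN (R : realType) (x : R) : cis (- x) = (cis x)^*.
Proof. by rewrite /cis mulrN cosN sinN. Qed.

Lemma norm_cis (R : realType) (x : R) : `|cis x| = 1.
Proof. by rewrite normc_def /= cos2Dsin2 sqrtr1. Qed.

Lemma cis_neq0 (R : realType) (x : R) : cis x != 0.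
Proof. by rewrite -normr_eq0 norm_cis oner_eq0. Qed.

Lemma cisV (R : realType) (x : R) : (cis x)^-1 = cis (- x).
Proof.
by apply: (mulfI (cis_neq0 x)); rewrite mulfV ?cis_neq0// -cisD subrr cis0.
Qed.

Lemma cis_nat (R : realType) (n : nat) : cis (n%:R : R) = 1.
Proof.
have -> : cis (n%:R : R) = cis 1 ^+ n.
  elim: n => [|n IH]; first by rewrite cis0.
  by rewrite -natr1 cisD IH exprSr.
by rewrite /cis mulr1 mulr_natl cos2pi sin2pi expr1n.
Qed.

Lemma cis_int (R : realType) (k : int) : cis (k%:~R : R) = 1.
Proof.
case: k => n; first exact: cis_nat.
by rewrite NegzE mulrNz cisN cis_nat rmorph1.
Qed.

Lemma cis_surj (R : realType) (w : R[i]) : `|w| = 1 -> exists x, w = cis x.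
Proof.
case: w => a b; rewrite normc_def /= => -[] h.
have {}h : a ^+ 2 + b ^+ 2 = 1.
  have n0 : 0 <= a ^+ 2 + b ^+ 2 by rewrite addr_ge0 ?sqr_ge0.
  by rewrite -(sqr_sqrtr n0) h expr1n.
have a1 : -1 <= a <= 1.
  rewrite -ler_norml -sqrtr_sqr -[leRHS]sqrtr1 -h.
  by apply: ler_wsqrtr; rewrite lerDl sqr_ge0.
have pi2 : 2 * pi != 0 :> R by rewrite mulf_neq0 ?pnatr_eq0// gt_eqF ?pi_gt0.
have E (x : R) : cis (x / (2 * pi)) = cos x +i* sin x.
  by rewrite /cis [2 * pi * _]mulrC divfK.
have sa : sin (acos a) = `|b|.
  by rewrite sin_acos// -h addrAC subrr add0r sqrtr_sqr.
case: (ger0P b) sa => b0 sa.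
  by exists (acos a / (2 * pi)); rewrite E acosK ?in_itv//= sa.
exists (- acos a / (2 * pi)).
by rewrite E cosN sinN acosK ?in_itv//= sa opprK.
Qed.

(** * Lower bound for a chord of the circle *)

Lemma sin_pi_ge (R : realType) (x : R) : 0 <= x <= 2^-1 -> 2 * x <= sin (pi * x).
Proof.
move=> /andP[x0 x1]; rewrite leNgt; apply/negP => hx.
have sx : 0 < x.
  by rewrite lt_neqAle x0 andbT; apply/eqP => E; move: hx; rewrite -E !mulr0 sin0 ltxx.
have x2 : x < 2^-1.
  rewrite lt_neqAle x1 andbT; apply/eqP => E; move: hx.
  by rewrite E mulfV// sin_pihalf ltxx.
pose f (y : R) := sin (pi * y) - 2 * y.
have df (y : R) : is_derive y (1 : R) f (pi * cos (pi * y) - 2).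
  have dZ (a : R) : is_derive y (1 : R) (fun z : R => a * z) a.
    apply: is_derive_eq (is_deriveZ a (is_derive_id y (1 : R))) _.
    by rewrite /GRing.scale/= mulr1.
  apply: is_derive_eq (is_deriveB (is_derive1_comp (is_derive_sin (pi * y)) (dZ pi)) (dZ 2)) _.
  by rewrite mulrC.
have cf (a b : R) : {within `[a, b], continuous f}.
  apply: continuous_subspaceT => y; apply: differentiable_continuous.
  by apply/derivable1_diffP; case: (df y).
(* [f] vanishes at 0 and 1/2 and is negative at [x], so its derivative is negative at some c1 < x
   and positive at some c2 > x, although the cosine decreases. *)
have [c1 c1i e1] := MVT sx (fun y _ => df y) (cf 0 x).
have [c2 c2i e2] := MVT x2 (fun y _ => df y) (cf x _).
move: c1i c2i e1 e2; rewrite !in_itv/= /f mulr0 sin0 mulr0 sin_pihalf mulfV//.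
move=> /andP[c10 c1x] /andP[c2x c22] e1 e2.
have p0 : 0 < (pi : R) by exact: pi_gt0.
have : cos (pi * c2) < cos (pi * c1).
  rewrite ltr_cos ?in_itv/=; nra.
have : pi * cos (pi * c1) - 2 < 0 by nra.
have : 0 < pi * cos (pi * c2) - 2 by nra.
by move=> ? ? ?; nra.
Qed.

(** By the half-angle formulas the chord has length 2 sin (pi |x|), to which [sin_pi_ge] applies. *)
Lemma normc_cisB1_ge (R : realType) (x : R) : `|x| <= 2^-1 ->
  4 * `|x| <= Normc.normc (cis x - 1).
Proof.
move=> hx.
have hs : 2 * `|x| <= sin (pi * `|x|) by apply: sin_pi_ge; rewrite normr_ge0.
rewrite /cis /Normc.normc /= subr0 -[leLHS]ger0_norm ?mulr_ge0// -sqrtr_sqr.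
apply: ler_wsqrtr.
have -> : cos (2 * pi * x) = cos (2 * pi * `|x|).
  by rewrite -cos_norm normrM ger0_norm// mulr_ge0// pi_ge0.
have -> : sin (2 * pi * x) ^+ 2 = sin (2 * pi * `|x|) ^+ 2.
  case: (ger0P x) => // _; by rewrite mulrN sinN sqrrN.
have -> : 2 * pi * `|x| = (pi * `|x|) *+ 2 by rewrite -[RHS]mulr_natl mulrA.
rewrite sin_mulr2n cos_mulr2n.
have := cos2Dsin2 (pi * `|x|); set c := cos _; set s := sin _ in hs *.
move: (normr_ge0 x) hs; set y := `|x|; move=> y0 hs e.
have -> : (c ^+ 2 *+ 2 - 1 - 1) ^+ 2 + (c * s *+ 2) ^+ 2 = 4 * s ^+ 2.
  have -> : c ^+ 2 *+ 2 - 1 - 1 = - (2 * s ^+ 2) by lra.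
  have -> : (c * s *+ 2) ^+ 2 = 4 * s ^+ 2 * c ^+ 2 by ring.
  by rewrite (_ : c ^+ 2 = 1 - s ^+ 2); [ring | lra].
nra.
Qed.

(** * Numerical estimates for the mass of the cells *)

Lemma sum_inv_sqr_lt (R : realFieldType) (n : nat) :
  \sum_(1 <= m < n.+1) (m%:R ^+ 2)^-1 < 7 / 4 :> R.
Proof.
case: n => [|[|n]]; first by rewrite big_geq//; lra.
  by rewrite big_nat1 expr1n; lra.
(* The sharpened bound telescopes; 7/4 makes it an equality for two terms. *)
suff h : \sum_(1 <= m < n.+3) (m%:R ^+ 2)^-1 <= 7 / 4 - (n.+2%:R)^-1 :> R.
  by apply: le_lt_trans h _; rewrite ltrBlDr ltrDl invr_gt0 ltr0n.
elim: n => [|n IH]; first by rewrite big_nat_recl// big_nat1; lra.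
rewrite big_nat_recr//=.
have x0 : 0 < n.+2%:R :> R by rewrite ltr0n.
move: IH; rewrite -[n.+3%:R]natr1; set x : R := n.+2%:R in x0 * => IH.
have x1 : 0 < x + 1 by lra.
have : x^-1 - (x + 1)^-1 = (x * (x + 1))^-1 by field; rewrite !gt_eqF.
have : ((x + 1) ^+ 2)^-1 <= (x * (x + 1))^-1.
  by rewrite lef_pV2 ?posrE ?exprn_gt0 ?mulr_gt0//; nra.
move=> h1 h2; apply: le_trans (lerD IH h1) _.
by rewrite -h2 addrA subrK.
Qed.

(** Convexity: the right-hand side is the chord over [0, 1]. *)
Lemma expr1D_le (R : realDomainType) (x : R) (d : nat) : 0 <= x <= 1 ->
  (1 + x) ^+ d <= 1 + (2 ^+ d - 1) * x.
Proof.
move=> /andP[x0 x1]; elim: d => [|d IH]; first by rewrite !expr0 subrr mul0r addr0.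
rewrite exprS; apply: le_trans (_ : (1 + x) * (1 + (2 ^+ d - 1) * x) <= _).
  by rewrite ler_wpM2l// addr_ge0.
have h : 1 <= 2 ^+ d :> R by rewrite exprn_ege1// ler1n.
rewrite [2 ^+ d.+1]exprS; set p := 2 ^+ d in h *.
have : 0 <= (p - 1) * (x * (1 - x)) by rewrite !mulr_ge0 ?subr_ge0.
by move=> ?; lra.
Qed.

(** For m >= 2, m^(-2d) <= 4 * 4^-d * m^-2, so the tail is at most 4 * 4^-d * (7/4 - 1). *)
Lemma sum_inv_expr_le (R : realFieldType) (d n : nat) : (0 < d)%N ->
  \sum_(1 <= m < n.+1) (m%:R ^+ (2 * d))^-1 <= 1 + 3 * (2 ^- d) ^+ 2 :> R.
Proof.
case: d => // d _.
have u0 : 0 <= (2 ^- d.+1) ^+ 2 :> R by rewrite sqr_ge0.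
case: n => [|n]; first by rewrite big_geq//; lra.
rewrite big_nat_recl// expr1n invr1 lerD2l.
have h (m : nat) : (m.+2%:R ^+ (2 * d.+1))^-1 <= 4 * (2 ^- d.+1) ^+ 2 * (m.+2%:R ^+ 2)^-1 :> R.
  have -> : 4 * (2 ^- d.+1) ^+ 2 = (2 ^+ (2 * d))^-1 :> R.
    rewrite [2 ^+ d.+1]exprS mulnC exprM; field.
    by rewrite expf_neq0// pnatr_eq0.
  rewrite -invfM lef_pV2 ?posrE ?mulr_gt0 ?exprn_gt0 ?ltr0n//.
  rewrite mulnS addnC exprD ler_wpM2r ?exprn_ge0//.
  by rewrite lerXn2r ?nnegrE// ler_nat.
have S := sum_inv_sqr_lt R n.+1.
rewrite big_nat_recl// expr1n invr1 in S.
apply: le_trans (_ : 4 * (2 ^- d.+1) ^+ 2 * \sum_(1 <= m < n.+1) (m.+1%:R ^+ 2)^-1 <= _).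
  rewrite mulr_sumr !big_nat; apply: ler_sum => -[|m] // _; exact: h.
by nra.
Qed.

(* Mass of the cubes outside the centre, e being the mass of the cells m >= 1
   in one half-line; the 2 ^+ d central cubes have mass 1 each. *)
Lemma kernel_mass_lt (R : realFieldType) (d : nat) (e : R) : (0 < d)%N ->
  0 <= e -> e <= (2 ^- d) ^+ 2 * (1 + 3 * (2 ^- d) ^+ 2) ->
  (2 * (1 + e)) ^+ d - 2 ^+ d < 1.
Proof.
move=> d0 e0; set u := 2 ^- d => he.
have p0 : 0 < 2 ^+ d :> R by rewrite exprn_gt0.
have p2 : 2 <= 2 ^+ d :> R.
  by case: d d0 {u he p0} => // d _; rewrite exprS ler_peMr// exprn_ege1// ler1n.
have pu : 2 ^+ d * u = 1 by rewrite mulfV ?gt_eqF.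
set p := 2 ^+ d in p0 p2 pu *.
have u0 : 0 < u by rewrite invr_gt0.
have u2 : u <= 1 / 2.
  have : 0 <= (p - 2) * u by rewrite mulr_ge0 ?subr_ge0// ltW.
  by move=> ?; lra.
have uu : u ^+ 2 <= 1 / 4 by rewrite expr2; nra.
have e1 : e <= 1.
  apply: le_trans he _; have : 0 <= u ^+ 2 by rewrite sqr_ge0.
  set v := u ^+ 2 in uu *; nra.
(* The mass p ((1 + e)^d - 1) is at most p (p - 1) e <= (1 - u) (1 + 3 u^2) = 1 - u (1 - 3 u + 3
   u^2), and the last bracket is positive. *)
have h : (1 + e) ^+ d <= 1 + (p - 1) * e by apply: expr1D_le; rewrite e0.
have a1 : (p - 1) * e <= (p - 1) * (u ^+ 2 * (1 + 3 * u ^+ 2)).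
  by rewrite ler_wpM2l// subr_ge0; lra.
have a2 : p * ((p - 1) * (u ^+ 2 * (1 + 3 * u ^+ 2))) = (1 - u) * (1 + 3 * u ^+ 2).
  rewrite [u ^+ 2]expr2.
  transitivity ((p * u) * (p * u - u) * (1 + 3 * (u * u))); first by ring.
  by rewrite pu; ring.
have a3 : (1 - u) * (1 + 3 * u ^+ 2) < 1.
  have : 0 < u * (1 - 3 * u + 3 * u ^+ 2) by rewrite mulr_gt0//; nra.
  by move=> ?; lra.
rewrite exprMn -/p; nra.
Qed.

(** * The one-variable kernel, with moduli taken in [R] through [Normc.normc] *)

Lemma normcX (R : realType) (z : R[i]) (n : nat) :
  Normc.normc (z ^+ n) = Normc.normc z ^+ n.
Proof.
elim: n => [|n IH]; first by rewrite !expr0 Normc.normc1.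
by rewrite !exprS Normc.normcM IH.
Qed.

Lemma normc_ge0 (R : realType) (z : R[i]) : 0 <= Normc.normc z.
Proof. by case: z => a b; rewrite sqrtr_ge0. Qed.

Lemma normc_real (R : realType) (x : R) : Normc.normc x%:C = `|x|.
Proof. by rewrite /= expr0n addr0 sqrtr_sqr. Qed.

Lemma normc_cis (R : realType) (x : R) : Normc.normc (cis x) = 1.
Proof. by rewrite /= cos2Dsin2 sqrtr1. Qed.

Lemma ler_normc_sum (R : realType) (I : Type) (r : seq I) (P : pred I)
    (F : I -> R[i]) :
  Normc.normc (\sum_(i <- r | P i) F i) <= \sum_(i <- r | P i) Normc.normc (F i).
Proof.
elim/big_ind2: _ => // [|x1 x2 y1 y2 h1 h2]; first by rewrite Normc.normc0.
by apply: le_trans (le_normcD _ _) _; rewrite lerD.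
Qed.

Lemma kernel_exists (R : realType) (d n : nat) : (0 < d)%N -> (0 < n)%N ->
  exists p : {poly R[i]},
    [/\ (size p <= n.+1)%N, p.[1] = 1,
        forall x : R, Normc.normc p.[cis x] <= 1 &
        forall (x : R) (m : nat), (0 < m)%N -> `|x| <= 2^-1 ->
          m%:R * (2 * d%:R / n%:R) <= `|x| ->
          Normc.normc p.[cis x] <= (2 ^- d) ^+ 2 * (m%:R ^+ (2 * d))^-1].
Proof.
(* 2 d N <= n controls the degree; n < 2 d (N + 1) gives the decay. *)
move=> d0 n0; pose N := (n %/ (2 * d))%N.
pose D : {poly R[i]} := ((N.+1%:R)^-1 : R)%:C *: \poly_(a < N.+1) 1.
have N0 : 0 < N.+1%:R :> R by rewrite ltr0n.
have DE z : D.[z] = ((N.+1%:R)^-1 : R)%:C * \sum_(a < N.+1) z ^+ a.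
  by rewrite hornerZ horner_poly; congr (_ * _); apply: eq_bigr => a _; rewrite mul1r.
have nD x : Normc.normc D.[cis x] = (N.+1%:R)^-1 * Normc.normc (\sum_(a < N.+1) cis x ^+ a).
  by rewrite DE Normc.normcM normc_real ger0_norm// invr_ge0 ltW.
exists (D ^+ (2 * d)); split.
- apply: leq_trans (size_poly_exp_leq _ _) _; rewrite ltnS.
  apply: leq_trans (leq_trunc_div n (2 * d)%N); rewrite leq_mul2r; apply/orP; right.
  have h : (size D <= N.+1)%N.
    by apply: leq_trans (size_scale_leq _ _) _; exact: size_poly.
  by rewrite -ltnS; apply: leq_trans (leqSpred _) _ => //; case: (size D) h.
- rewrite horner_exp DE (eq_bigr (fun=> 1)) => [|a _]; last by rewrite expr1n.
  rewrite sumr_const card_ord -(rmorph_nat (real_complex R)) -rmorphM mulVf ?gt_eqF//.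
  by rewrite expr1n.
- move=> x; rewrite horner_exp normcX exprn_ile1 ?normc_ge0// nD mulrC ler_pdivrMr// mul1r.
  apply: le_trans (ler_normc_sum _ _ _) _.
  rewrite (eq_bigr (fun=> 1)) => [|a _]; last by rewrite normcX normc_cis expr1n.
  by rewrite sumr_const card_ord.
move=> x m m0 x2 hm; rewrite horner_exp normcX.
(* The target is a 2d-th power, so it suffices to bound [D] itself by 1 / (2 m). *)
have -> : (2 ^- d) ^+ 2 * (m%:R ^+ (2 * d))^-1 = ((2 * m%:R)^-1) ^+ (2 * d) :> R.
  by rewrite !exprVn -!invfM exprMn mulnC !exprM.
have mp : 0 < m%:R :> R by rewrite ltr0n.
rewrite lerXn2r ?nnegrE ?normc_ge0 ?invr_ge0 ?mulr_ge0//.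
rewrite nD; set v := Normc.normc _.
have v0 : 0 <= v by exact: normc_ge0.
(* Times [cis x - 1], the geometric sum becomes a difference of two unit numbers. *)
have hv : v * (4 * `|x|) <= 2.
  apply: le_trans (_ : v * Normc.normc (cis x - 1) <= _).
    by rewrite ler_wpM2l// normc_cisB1_ge.
  rewrite mulrC -Normc.normcM -subrX1.
  apply: le_trans (le_normcD _ _) _.
  rewrite normcX normc_cis expr1n normcN Normc.normc1; lra.
have hN : m%:R <= N.+1%:R * `|x|.
  have n1 : 0 < n%:R :> R by rewrite ltr0n.
  have d1 : 0 < 2 * d%:R :> R by rewrite mulr_gt0 ?ltr0n.
  apply: le_trans (_ : N.+1%:R * (m%:R * (2 * d%:R / n%:R)) <= _); last first.
    by rewrite ler_wpM2l// ltW.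
  have -> : N.+1%:R * (m%:R * (2 * d%:R / n%:R)) = m%:R * (N.+1%:R * (2 * d%:R) / n%:R) :> R by ring.
  rewrite ler_pMr// ler_pdivlMr// mul1r -!natrM ler_nat.
  by apply/ltnW/ltn_ceil; rewrite muln_gt0.
rewrite mulrC ler_pdivrMr// mulrC ler_pdivlMr ?mulr_gt0//.
nra.
Qed.

(** * Summing the product kernel over cells of side e *)

Lemma mx_norm_attained (R : realDomainType) (d : nat) (v : 'rV[R]_d) :
  0 < `|v| -> exists i, `|v| = `|v 0 i|.
Proof.
move=> v0; have /mx_norm_neq0[[a i] /= h] : mx_norm v != 0 by rewrite gt_eqF.
by exists i; rewrite -(ord1 a).
Qed.

Lemma norm_sub_lt_cell (R : realType) (x y e : R) : 0 < e ->
  (0 <= x) = (0 <= y) ->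
  Num.truncn (`|x| / e) = Num.truncn (`|y| / e) -> `|x - y| < e.
Proof.
move=> e0 sxy h.
have x0 : 0 <= `|x| / e by rewrite divr_ge0// ltW.
have y0 : 0 <= `|y| / e by rewrite divr_ge0// ltW.
have := truncn_itv x0; have := truncn_itv y0; rewrite h -natr1.
set m : R := _%:R.
rewrite !ler_pdivlMr// !ltr_pdivrMr// => /andP[a1 a2] /andP[b1 b2].
rewrite ltr_norml; move: sxy a1 a2 b1 b2.
case: (ger0P x) => hx; case: (ger0P y) => hy // _ a1 a2 b1 b2; lra.
Qed.

(* The cell of a point records, for each coordinate, its sign and the integer
   part of its absolute value in units of e. *)
Lemma separated_sum_lt1 (R : realType) (d n : nat) (J : finType) (e : R)
    (j0 : J) (x w : J -> 'I_d -> R) :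
  (0 < d)%N -> 0 < e ->
  (forall i, x j0 i = 0) ->
  (forall l i, `|x l i| < n.+1%:R * e) ->
  (forall l l', l != l' -> exists i, e <= `|x l i - x l' i|) ->
  (forall l i, 0 <= w l i <= 1) ->
  (forall l i m, (0 < m)%N -> m%:R * e <= `|x l i| ->
     w l i <= (2 ^- d) ^+ 2 * (m%:R ^+ (2 * d))^-1) ->
  \sum_(l | l != j0) \prod_i w l i < 1.
Proof.
move=> d0 e0 xj0 xn hsep w01 wm.
pose tr l i := Num.truncn (`|x l i| / e).
have xe0 l i : 0 <= `|x l i| / e by rewrite divr_ge0// ltW.
have trn l i : (tr l i < n.+1)%N.
  by rewrite truncn_lt_nat// ltr_pdivrMr.
pose g (m : nat) : R := (2 ^- d) ^+ 2 * (m%:R ^+ (2 * d))^-1.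
have g0 m : 0 <= g m by rewrite mulr_ge0 ?invr_ge0 ?exprn_ge0// invr_ge0 exprn_ge0.
(* The decay bound needs m > 0; on cell 0 only the trivial bound 1 is available. *)
pose G (c : bool * 'I_n.+1) : R := if c.2 == ord0 then 1 else g c.2.
have G0 c : 0 <= G c by rewrite /G; case: ifP.
(* By [trn] the cell numbers stay below n + 1, so [inord] never falls back to its default. *)
pose cell l : {ffun 'I_d -> bool * 'I_n.+1} :=
  [ffun i => (0 <= x l i, inord (tr l i))].
have wG l i : w l i <= G (cell l i).
  rewrite /G ffunE/=; case: eqP => [_|]; first by case/andP: (w01 l i).
  move=> /eqP; rewrite -val_eqE /= inordK// -lt0n => tr0; apply: wm => //.
  by rewrite -ler_pdivlMr// truncn_le.
have cell_inj : injective cell.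
  move=> l l' h; apply/eqP; apply: contraT => /hsep[k]; rewrite leNgt => /negP[].
  have := congr1 (fun f : {ffun 'I_d -> bool * 'I_n.+1} => f k) h.
  rewrite !ffunE => -[s /(congr1 val)]; rewrite /= !inordK// => t.
  exact: norm_sub_lt_cell.
(* A point in a central cube is closer than e to the origin, which is the point of [j0]. *)
pose Z := [pred c : bool * 'I_n.+1 | c.2 == ord0].
have cellZ l : l != j0 -> cell l \notin ffun_on Z.
  move=> /hsep[k]; rewrite xj0 subr0 => hi; apply/negP => /ffun_onP/(_ k).
  rewrite !ffunE inE/= -val_eqE /= inordK// => /eqP tr0.
  have := real_truncnS_gt (num_real (`|x l k| / e)).
  by rewrite -/(tr l k) tr0 ltr_pdivrMr// mul1r ltNge hi.
pose PG (c : {ffun 'I_d -> bool * 'I_n.+1}) := \prod_i G (c i).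
have PG0 c : 0 <= PG c by apply: prodr_ge0.
apply: le_lt_trans (_ : \sum_(l | l != j0) PG (cell l) < 1).
  by apply: ler_sum => l _; apply: ler_prod => i _; rewrite wG andbT; case/andP: (w01 l i).
have -> : \sum_(l | l != j0) PG (cell l) =
    \sum_(c in [set cell l | l in predC1 j0]%SET) PG c.
  by rewrite big_imset// => a b _ _; exact: cell_inj.
apply: le_lt_trans (_ : \sum_(c | c \notin ffun_on Z) PG c < 1).
  rewrite big_mkcond [leRHS]big_mkcond; apply: ler_sum => c _.
  case: ifP => [/imsetP[l]|_]; last by case: ifP.
  by rewrite inE => lj ->; rewrite cellZ.
have sumZ : \sum_(c in ffun_on Z) PG c = 2 ^+ d.
  rewrite /PG -(bigA_distr_big Z (fun=> G)) prodr_const card_ord; congr (_ ^+ _).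
  rewrite (eq_bigr (fun=> 1)) => [|c /eqP cZ]; last by rewrite /G cZ eqxx.
  rewrite (eq_bigl (fun c : bool * 'I_n.+1 => true && (c.2 == ord0)))//.
  rewrite -(pair_big predT (fun k => k == ord0) (fun _ _ => 1))/= big_bool /=.
  by rewrite !big_pred1_eq.
pose s : R := \sum_(1 <= m < n.+1) g m.
(* The sum factors over coordinates, each with two half-lines of mass 1 + s. *)
have sumG : \sum_c PG c = (2 * (1 + s)) ^+ d.
  rewrite /PG -(bigA_distr_bigA (fun=> G)) prodr_const card_ord; congr (_ ^+ _).
  rewrite (eq_bigr (fun c : bool * 'I_n.+1 => (fun _ k => G (true, k)) c.1 c.2))//.
  rewrite -(pair_bigA _ (fun _ k => G (true, k)))/= big_bool /=.
  have -> : \sum_(k < n.+1) G (true, k) = 1 + s.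
    rewrite big_ord_recl /G/=; congr (_ + _).
    by rewrite /s big_add1 /= big_mkord.
  by rewrite mulr_natl.
have -> : \sum_(c | c \notin ffun_on Z) PG c = (2 * (1 + s)) ^+ d - 2 ^+ d.
  by rewrite -sumG -sumZ [X in X - _](bigID (mem (ffun_on Z)))/= addrC addrK.
apply: kernel_mass_lt => //; first exact: sumr_ge0.
by rewrite /s -mulr_sumr ler_wpM2l ?sum_inv_expr_le// sqr_ge0.
Qed.

(** * Linear independence of separated points, and interpolation *)

Lemma cis_independent (R : realType) (d n : nat) (J : finType)
    (t : J -> 'rV[R]_d) (c : J -> R[i]) :
  (0 < d)%N -> (0 < n)%N ->
  (forall j l (r : 'rV[int]_d), j != l ->
     2 * d%:R / n%:R <= `|t j - t l + map_mx intr r|) ->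
  (forall k : multi_index d n, \sum_j c j * \prod_i torus_exp (t j) 0 i ^+ k i = 0) ->
  forall j, c j = 0.
Proof.
move=> d0 n0 tsep hc j1.
have [p [sp p1 ple1 pdec]] := kernel_exists R d0 n0.
set e := 2 * d%:R / n%:R in tsep pdec.
have nR0 : 0 < n%:R :> R by rewrite ltr0n.
have dR0 : 0 < d%:R :> R by rewrite ltr0n.
have e0 : 0 < e by rewrite divr_gt0// mulr_gt0.
suff [j0 j0max cj0] : exists2 j0, (forall j, Normc.normc (c j) <= Normc.normc (c j0)) & c j0 = 0.
  apply: Normc.eq0_normc; apply/le_anti; rewrite normc_ge0 andbT.
  by apply: le_trans (j0max j1) _; rewrite cj0 Normc.normc0.
(* Diagonal dominance is tested at a coefficient of largest modulus. *)
have [j0 _ j0max] := @arg_maxP _ _ _ j1 predT (fun j => Normc.normc (c j)) isT.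
exists j0 => [j|]; first exact: j0max.
pose y l i : R := t l 0 i - t j0 0 i.
(* Rounding brings each coordinate of t_l - t_j0 into [-1/2, 1/2]; separation survives because it
   holds modulo all integer shifts. *)
pose r l i := Num.floor (y l i + 2^-1).
pose x l i := y l i - (r l i)%:~R.
have xj0 i : x j0 i = 0.
  have f0 : Num.floor (2^-1 : R) = 0.
    by apply: floor_def; rewrite add0r; apply/andP; split; lra.
  by rewrite /x /r /y subrr !add0r f0 oppr0.
have x2 l i : `|x l i| <= 2^-1.
  have /andP[] := floor_itv (y l i + 2^-1); rewrite -/(r l i) intrD => a b.
  by rewrite /x ler_norml; apply/andP; split; lra.
have xsep l l' : l != l' -> exists i, e <= `|x l i - x l' i|.
  move=> ll'; have h := tsep _ _ (\row_i (r l' i - r l i)) ll'.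
  have [k hk] := mx_norm_attained (lt_le_trans e0 h).
  exists k; apply: le_trans h _; rewrite hk !mxE intrB.
  by rewrite le_eqVlt; apply/orP; left; apply/eqP; congr `|_|; rewrite /x /y; ring.
pose w l i := Normc.normc p.[cis (x l i)].
have wE l i : cis (x l i) = torus_exp (t l) 0 i * (torus_exp (t j0) 0 i)^-1.
  rewrite !mxE -!/(cis _) cisV -cisD -/(y l i).
  have -> : y l i = x l i + (r l i)%:~R by rewrite subrK.
  by rewrite cisD cis_int mulr1.
have S1 : \sum_(l | l != j0) \prod_i w l i < 1.
  apply: (@separated_sum_lt1 _ d n _ e j0 x) => //.
  - move=> l i; apply: le_lt_trans (x2 l i) _.
    (* n e = 2 d exceeds 1/2, so n + 1 cells cover each half-line. *)
    apply: lt_le_trans (_ : n%:R * e <= _); last by rewrite ler_pM2r// ler_nat.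
    rewrite mulrC divfK ?gt_eqF//; have : 1 <= d%:R :> R by rewrite ler1n.
    by move=> ?; lra.
  - by move=> l i; rewrite normc_ge0 ple1.
  - by move=> l i m m0 hm; apply: pdec.
(* The product kernel centred at t_j0 has degree at most n in each variable, so it is a combination
   of the monomials annihilated by [hc]. *)
have K0 : \sum_l c l * \prod_i p.[cis (x l i)] = 0.
  pose u i := (torus_exp (t j0) 0 i)^-1.
  transitivity (\sum_(k : multi_index d n) (\prod_i (p`_(k i) * u i ^+ k i)) *
      \sum_l c l * \prod_i torus_exp (t l) 0 i ^+ k i).
    under [RHS]eq_bigr => k _ do rewrite mulr_sumr.
    rewrite exchange_big; apply: eq_bigr => l _ /=.
    under eq_bigr => i _ do rewrite (horner_coef_wide _ sp).
    rewrite bigA_distr_bigA mulr_sumr; apply: eq_bigr => k _.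
    rewrite mulrCA -big_split/=; congr (_ * _); apply: eq_bigr => i _.
    by rewrite wE exprMn mulrAC mulrA.
  by apply: big1 => k _; rewrite hc mulr0.
have E1 : \prod_i p.[cis (x j0 i)] = 1 by apply: big1 => i _; rewrite xj0 cis0.
have normc_prod l : Normc.normc (\prod_i p.[cis (x l i)]) = \prod_i w l i.
  by apply: (big_morph _ (@Normc.normcM R) (Normc.normc1 R)).
rewrite (bigD1 j0)//= E1 mulr1 in K0.
have cE : c j0 = - \sum_(l | l != j0) c l * \prod_i p.[cis (x l i)].
  by apply/eqP; rewrite -addr_eq0 K0.
have hle : Normc.normc (c j0) <= Normc.normc (c j0) * \sum_(l | l != j0) \prod_i w l i.
  rewrite [X in Normc.normc X <= _]cE normcN mulr_sumr.
  apply: le_trans (ler_normc_sum _ _ _) _; apply: ler_sum => l _.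
  rewrite Normc.normcM normc_prod ler_wpM2r ?prodr_ge0//; last exact: j0max.
  by move=> i _; exact: normc_ge0.
apply: Normc.eq0_normc; apply/eqP; rewrite eq_le normc_ge0 andbT.
move: hle S1 (normc_ge0 (c j0)); set S := \sum_(_ | _) _; set a := Normc.normc _.
by move=> h1 h2 h3; nra.
Qed.

(** The Vandermonde matrix has independent rows; the columns of a right inverse are the Lagrange
    polynomials. *)
Lemma interpolation (R : realType) (d n m : nat) (t : 'I_m -> 'rV[R]_d) :
  (0 < d)%N -> (0 < n)%N ->
  (forall j l (r : 'rV[int]_d), j != l ->
     2 * d%:R / n%:R <= `|t j - t l + map_mx intr r|) ->
  forall j0, exists p : 'cV[R[i]]_#|{: multi_index d n}|, forall j,
    \sum_k p k 0 * \prod_i torus_exp (t j) 0 i ^+ (enum_val k : multi_index d n) i = (j == j0)%:R.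
Proof.
move=> d0 n0 tsep j0.
pose A : 'M[R[i]]_(m, #|{: multi_index d n}|) :=
  \matrix_(j, k) \prod_i torus_exp (t j) 0 i ^+ (enum_val k : multi_index d n) i.
have /row_freeP[B AB] : row_free A.
  apply: inj_row_free => v vA; apply/rowP => j; rewrite mxE.
  apply: (cis_independent (c := v 0) d0 n0 tsep) => k.
  have := congr1 (fun u : 'rV[R[i]]__ => u 0 (enum_rank k)) vA.
  rewrite !mxE => E0; rewrite -[RHS]E0; apply: eq_bigr => l _.
  by rewrite mxE enum_rankK.
exists (col j0 B) => j.
have := congr1 (fun u : 'M[R[i]]__ => u j j0) AB.
rewrite !mxE => <-; apply: eq_bigr => k _.
by rewrite !mxE mulrC.
Qed.

(** * The Toeplitz kernel as polynomials vanishing on Omega *)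

Lemma meval_poly_of_vec (R : realType) (d n : nat)
    (p : 'cV[R[i]]_#|{: multi_index d n}|) (z : 'I_d -> R[i]) :
  meval z (poly_of_vec p) = \sum_k p k 0 * \prod_i z i ^+ (enum_val k : multi_index d n) i.
Proof.
rewrite /poly_of_vec raddf_sum/=; apply: eq_bigr => k _.
rewrite mevalZ mevalX; congr (_ * _); apply: eq_bigr => i _; congr (_ ^+ _).
by rewrite /multi_index_mnm /fun_of_multinom/= tnth_mktuple.
Qed.

(** Splitting z_j^(k - l) gives the factorization A^* D A. The factor z_j^(-l) is written as a power
    of the conjugate point, so that [cis_independent] applies at the points - t_j. *)
Lemma toeplitz_mulmxE (R : realType) (d n M : nat) (t : 'I_M -> 'rV[R]_d)
    (c : 'I_M -> R[i]) (p : 'cV[R[i]]_#|{: multi_index d n}|) l :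
  (toeplitz_mx n (fun k => \sum_(j < M) c j * zpow (torus_exp (t j)) k) *m p) l 0 =
  \sum_j (c j * meval (torus_exp (t j) 0) (poly_of_vec p)) *
    \prod_i torus_exp (- t j) 0 i ^+ (enum_val l : multi_index d n) i.
Proof.
rewrite mxE; under eq_bigr => k _ do rewrite mxE mulr_suml.
rewrite exchange_big; apply: eq_bigr => j _ /=.
rewrite meval_poly_of_vec mulr_sumr mulr_suml; apply: eq_bigr => k _.
rewrite mulrAC -!mulrA; congr (_ * (_ * _)).
rewrite /zpow -big_split/=; apply: eq_bigr => i _.
have z0 : torus_exp (t j) 0 i != 0 by rewrite mxE cis_neq0.
rewrite !mxE in z0 *; rewrite expfzDr//; congr (_ * _).
by rewrite -[LHS]exprz_inv -!/(cis _) cisV.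
Qed.

Theorem theorem3p9 (R : realType) (d n M : nat)
    (hd : (0 < d)%N) (hn : (0 < n)%N) (hM : (0 < M)%N)
    (t : 'I_M -> 'rV[R]_d) (ht : forall j i, 0 <= t j 0 i < 1)
    (q : R) (hq : 0 < q) (hsep : q_separated q t)
    (fhat : 'I_M -> R[i]) (hfhat : forall j, fhat j != 0)
    (hnq : 2 * d%:R * q^-1 <= n%:R) :
  let z := fun j : 'I_M => torus_exp (t j) in
  let Omega : set 'rV[R[i]]_d := [set z j | j in [set: 'I_M]] in
  let f := fun k : 'rV[int]_d => \sum_(j < M) fhat j * zpow (z j) k in
  let T := toeplitz_mx n f in
  Omega `<=` zero_locus (ker_poly T) `&` torus R d /\
  zero_locus (ker_poly T) `&` torus R d `<=`
    [set w | exists z0 (s : 'rV[R]_d),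
       [/\ Omega z0, `|s| < 2 * d%:R / n%:R & w = hadamard z0 (torus_exp s)]].
Proof.
move=> z Omega f T.
have nR0 : 0 < n%:R :> R by rewrite ltr0n.
have tsep j l (r : 'rV[int]_d) : j != l ->
    2 * d%:R / n%:R <= `|t j - t l + map_mx intr r|.
  move=> jl; apply: le_trans (_ : q <= _).
    by rewrite ler_pdivrMr// [q * _]mulrC -ler_pdivrMr.
  rewrite -lee_fin; apply: le_trans (ltW hsep) _.
  by apply: ereal_inf_lbound; exists r, j, l.
have TE := toeplitz_mulmxE t fhat.
split.
  move=> _ [j _ <-]; split; last by move=> i; rewrite mxE; exact: norm_cis.
  move=> _ [p Tp <-].
  (* Injectivity of A^*: the reflected points - t_j are as separated as the t_j. *)
  have hc : forall j, fhat j * meval (z j 0) (poly_of_vec p) = 0.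
    apply: (@cis_independent R d n _ (fun j => - t j)) => // [a b r ab|k].
      have -> : - t a - - t b + map_mx intr r = - (t a - t b + map_mx intr (- r)).
        by rewrite map_mxN !opprD !opprK.
      by rewrite normrN tsep.
    have := congr1 (fun u : 'cV[R[i]]__ => u (enum_rank k) 0) Tp.
    by rewrite /T /f TE mxE => E0; rewrite -[RHS]E0; apply: eq_bigr => l _; rewrite enum_rankK.
  by have /eqP := hc j; rewrite mulf_eq0 (negPf (hfhat j)) => /eqP.
move=> w [wV wT].
have /choice[s0 s0E] : forall i, exists x, w 0 i = cis x by move=> i; exact: cis_surj.
pose s := \row_i s0 i.
have wE : w = torus_exp s by apply/rowP => i; rewrite !mxE s0E.
have [[j [r near]]|far] := pselect (exists j (r : 'rV[int]_d),
    `|s - t j + map_mx intr r| < 2 * d%:R / n%:R).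
  (* The integer shift [r] disappears under [cis]. *)
  exists (z j), (s - t j + map_mx intr r); split => //; first by exists j.
  apply/rowP => i; rewrite wE !mxE -!/(cis _) -cisD.
  by rewrite addrA [_ + (s0 i - _)]addrC subrK cisD cis_int mulr1.
(* The far point takes index 0 in the enlarged family; its Lagrange polynomial is 1 at [w] and 0 on
   [Omega]. *)
pose t' (a : 'I_M.+1) := if unlift ord0 a is Some j then t j else s.
have t'0 : t' ord0 = s by rewrite /t' unlift_none.
have t'S j : t' (lift ord0 j) = t j by rewrite /t' liftK.
have sfar j r : 2 * d%:R / n%:R <= `|s - t j + map_mx intr r|.
  by rewrite leNgt; apply/negP => h; apply: far; exists j, r.
have t'sep a b (r : 'rV[int]_d) : a != b ->
    2 * d%:R / n%:R <= `|t' a - t' b + map_mx intr r|.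
  case: (unliftP ord0 a) => [a'|] ->; case: (unliftP ord0 b) => [b'|] ->;
    rewrite ?t'0 ?t'S ?eqxx//.
  - by rewrite (inj_eq lift_inj); exact: tsep.
  - move=> _; have -> : t a' - s + map_mx intr r = - (s - t a' + map_mx intr (- r)).
      by rewrite map_mxN !opprD !opprK [- s + _]addrC.
    by rewrite normrN sfar.
have [p pE] := interpolation hd hn t'sep ord0.
have pz j : meval (z j 0) (poly_of_vec p) = 0.
  by rewrite meval_poly_of_vec /z -t'S pE -(inj_eq val_inj).
have pw : meval (w 0) (poly_of_vec p) = 1.
  by rewrite meval_poly_of_vec wE -t'0 pE eqxx.
have Tp : T *m p = 0.
  apply/colP => l; rewrite /T /f TE mxE; apply: big1 => j _.
  by rewrite -/(z j) pz mulr0 mul0r.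
have /eqP := wV _ (ex_intro2 _ _ p Tp erefl).
by rewrite pw oner_eq0.
Qed.
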